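(* Let $\mathcal{G}$ be a DAG, let $\mathbb{Z}$ be a finite collection of realizations $\mathbf{z}$ of subsets $\mathbf{Z}\subseteq\mathbf{V}$, and suppose the interventional distributions $\{P(\mathbf{V}_{\mathbf{z}}):\mathbf{z}\in\mathbb{Z}\}$ are given. Fix a counterfactual event $(\mathbf{y}_{\mathbf{x}},\dots,\mathbf{z}_{\mathbf{w}})$. Let $l$ and $r$ be, respectively, the minimum and maximum of $P_N(\mathbf{y}_{\mathbf{x}},\dots,\mathbf{z}_{\mathbf{w}})$ over $N\in\mathcal{N}(\mathcal{G})$ subject to $P_N(\mathbf{v}_{\mathbf{z}})=P(\mathbf{v}_{\mathbf{z}})$ for all $\mathbf{v}$ and all $\mathbf{z}\in\mathbb{Z}$ (a polynomial program in the parameters of the canonical SCMs). Then $[l,r]$ is a tight bound on $P(\mathbf{y}_{\mathbf{x}},\dots,\mathbf{z}_{\mathbf{w}})$: $l$ and $r$ are equal, respectively, to the minimum and maximum of $P_M(\mathbf{y}_{\mathbf{x}},\dots,\mathbf{z}_{\mathbf{w}})$ over all $M\in\mathcal{M}(\mathcal{G})$ subject to $P_M(\mathbf{v}_{\mathbf{z}})=P(\mathbf{v}_{\mathbf{z}})$ for all $\mathbf{v}$ and all $\mathbf{z}\in\mathbb{Z}$.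
   Context: An SCM $M=\langle\mathbf{V},\mathbf{U},\mathcal{F},P\rangle$ consists of a finite set $\mathbf{V}$ of endogenous variables with finite domains $\Omega_V$; a finite set $\mathbf{U}$ of mutually independent exogenous variables with arbitrary domains and probability measures; and functions $v\gets f_V(pa_V,u_V)$, $PA_V\subseteq\mathbf{V}$, $U_V\subseteq\mathbf{U}$. Its causal diagram has nodes $\mathbf{V}\cup\mathbf{U}$ and arrows from $PA_V\cup U_V$ into $V$, assumed acyclic; $M$ is compatible with $\mathcal{G}$ if its diagram equals $\mathcal{G}$. Potential responses $\mathbf{Y}_{\mathbf{x}}(\mathbf{u})$ are the solutions for $\mathbf{Y}$ in the submodel where variables in $\mathbf{X}$ are set to the constants $\mathbf{x}$, given $\mathbf{U}=\mathbf{u}$, and $P_M(\mathbf{y}_{\mathbf{x}},\dots,\mathbf{z}_{\mathbf{w}})$ is the probability (under the exogenous distribution) that $\mathbf{Y}_{\mathbf{x}}(\mathbf{u})=\mathbf{y},\dots,\mathbf{Z}_{\mathbf{w}}(\mathbf{u})=\mathbf{z}$; $P(\mathbf{v}_{\mathbf{z}})$ is the case $\mathbf{Y}=\mathbf{V}$, and $\mathbf{z}=\emptyset$ gives the observational distribution. $\mathcal{M}(\mathcal{G})$ is the set of all SCMs compatible with $\mathcal{G}$. $\mathcal{N}(\mathcal{G})$ is the set of SCMs compatible with $\mathcal{G}$ in which every exogenous $U$ has a discrete domain of cardinality $\prod_{V\in\mathbf{C}(U)}|\Omega_{PA_V}\mapsto\Omega_V|$, where $\Omega_{PA_V}\mapsto\Omega_V$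 is the set of all functions from $\Omega_{PA_V}$ to $\Omega_V$ and $\mathbf{C}(U)$ is the set of all $V\in\mathbf{V}$ for which there is a sequence $U_1=U,\dots,U_n\in\mathbf{U}$ with $U_n\in U_V$ and consecutive $U_i,U_{i+1}$ having a common child in $\mathcal{G}$. *)

(* Defs.v *)
From HB Require Import structures.
From mathcomp Require Import all_boot all_order all_algebra.
From mathcomp Require Import all_classical all_reals.
From mathcomp Require Import measure probability.
Unset Printing Implicit Defensive.
Import Order.TTheory GRing.Theory Num.Theory.
Local Open Scope classical_set_scope.
Local Open Scope ring_scope.

(* A causal diagram: endogenous nodes [dV], exogenous nodes [dU],
   parents [pa v] (endogenous) and exogenous parents [ex v] of each endogenous
   [v]; exogenous nodes have no parents.  Edges w -> v for w \in pa v; the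
   diagram is acyclic: no edge w -> v followed by a directed path v ->* w. *)
Record dag := DAG {
  dV : finType;
  dU : finType;
  pa : dV -> {set dV};
  ex : dV -> {set dU};
  dag_acyclic : forall w v, w \in pa v ->
      ~~ connect [rel a b | a \in pa b] v w
}.

Section SCM.
Variable R : realType.
Variable G : dag.
Variable Om : dV G -> finType.

Definition asg := forall v : dV G, Om v.

(* An SCM compatible with G.  The exogenous variables are mutually independent
   random elements [uX u] (with arbitrary measurable domains [uT u]) on a
   probability space [(sO, sP)]; [f v] is the structural function of v, which
   depends only on the values of the parents [pa G v] and (measurably) only on the
   exogenous variables in [ex G v], i.e. f v x is measurable w.r.t. the
   sigma-algebra generated by { uX u | u \in ex G v }. *)
Record scm := SCM {
  sd : measure_display;
  sO : measurableType sd;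
  sP : probability sO R;
  ud : dU G -> measure_display;
  uT : forall u, measurableType (ud u);
  uX : forall u, sO -> uT u;
  f : forall v, asg -> sO -> Om v;
  uX_meas : forall u, measurable_fun setT (uX u);
  uX_indep : forall A : forall u, set (uT u), (forall u, measurable (A u)) ->
      fine (sP (\bigcap_(u in [set: dU G]) (uX u @^-1` A u)))
      = \prod_(u : dU G) fine (sP (uX u @^-1` A u));
  f_pa : forall v (x x' : asg) o, (forall w, w \in pa G v -> x w = x' w) ->
      f v x o = f v x' o;
  f_meas : forall v (x : asg) (y : Om v),
      <<s \bigcup_(u in [set u | u \in ex G v])
            [set uX u @^-1` B | B in [set B : set (uT u) | measurable B]] >>
        (f v x @^-1` [set y])
}.

(* potential responses: s is the solution of the submodel M_x (variables in X
   set to x) for the exogenous outcome o *)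
Definition solves (M : scm) (X : {set dV G}) (x : asg) (o : sO M) (s : asg) :=
  forall v, s v = if v \in X then x v else f M v s o.

Record cterm := CTerm { cY : {set dV G}; cy : asg; cX : {set dV G}; cx : asg }.

Definition cevent (M : scm) (t : cterm) : set (sO M) :=
  [set o | exists s, solves M (cX t) (cx t) o s /\
                     forall v, v \in cY t -> s v = cy t v].

Definition cfprob (M : scm) (n : nat) (ev : 'I_n -> cterm) : \bar R :=
  sP M (\bigcap_(i in [set: 'I_n]) cevent M (ev i)).

Record intv := Intv { iZ : {set dV G}; iz : asg }.

Definition intprob (M : scm) (z : intv) (v : asg) : \bar R :=
  sP M (cevent M (CTerm (finset.setTfor (dV G)) v (iZ z) (iz z))).

Definition cchild : rel (dU G) :=
  fun u u' => [exists v, (u \in ex G v) && (u' \in ex G v)].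

Definition Cset (u : dU G) : {set dV G} :=
  [set v | [exists u', connect cchild u u' && (u' \in ex G v)]].

Definition pa_asg (v : dV G) :=
  {dffun forall w : {w : dV G | w \in pa G v}, Om (sval w)}.

Definition can_card (u : dU G) : nat :=
  (\prod_(v in Cset u) #|{ffun pa_asg v -> Om v}|)%N.

Definition canonical_scm (M : scm) : Prop :=
  forall u, (exists e : 'I_(can_card u) -> uT M u, bijective e) /\
            (forall A : set (uT M u), measurable A).

Definition is_min (S : scm -> Prop) (q : scm -> \bar R) (l : R) : Prop :=
  (exists M, S M /\ q M = l%:E) /\ (forall M, S M -> (l%:E <= q M)%E).
Definition is_max (S : scm -> Prop) (q : scm -> \bar R) (r : R) : Prop :=
  (exists M, S M /\ q M = r%:E) /\ (forall M, S M -> (q M <= r%:E)%E).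

End SCM.

Arguments intprob {R G Om} M z v.
Arguments cfprob {R G Om} M {n} ev.
Arguments canonical_scm {R G Om} M.
Arguments is_min {R G Om} S q l.
Arguments is_max {R G Om} S q r.

(* Main.v *)
Require Import Defs.
From HB Require Import structures.
From mathcomp Require Import all_boot all_order all_algebra.
From mathcomp Require Import all_classical all_reals.
From mathcomp Require Import measure probability.
From mathcomp Require Import topology ereal normedtype sequences function_spaces.
Set Implicit Arguments.
Unset Strict Implicit.
Unset Printing Implicit Defensive.
Import Order.TTheory GRing.Theory Num.Theory.
Import numFieldNormedType.Exports.
Local Open Scope classical_set_scope.
Local Open Scope ring_scope.

(* Every counterfactual probability is determined by the joint law of the
   response functions r_v : Omega_{PA_v} -> Omega_v, so it suffices to realise the
   response law of an arbitrary model M by a canonical one.  Each event {r_v = y}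
   lies in the sigma-algebra generated by the exogenous parents of v, hence is
   approximated by events that depend on finite-valued codes of these parents;
   this gives finite models whose response law is arbitrarily close to that of M.
   In a finite model the exogenous variables are treated one at a time: the
   response law factors over C(u) and its complement, only the first factor
   involves the distribution of u, and it is a conic combination, with that
   distribution as weights, of vectors in a space of dimension
   prod_{v in C(u)} |Omega_{PA_v} -> Omega_v|.  By Caratheodory's theorem the
   distribution of u can be replaced by one with at most that many atoms.  The
   canonical response laws form a finite union of continuous images of a compact
   cube, so the approximating laws have an exactly canonical limit. *)

(** * Finite product distributions *)

Section ProductExpectation.
Variable R : realFieldType.

Definition depends_on (I T S : Type) (K : I -> Prop) (F : (I -> T) -> S) :=
  forall a b, (forall i, K i -> a i = b i) -> F a = F b.

Variable U : finType.

Definition weight (L : finType) (p : U -> L -> R) (a : {ffun U -> L}) : R :=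
  \prod_u p u (a u).

(** [F] takes plain functions, so that labels can be recoded inside it; the sum runs over finite
    functions. *)
Definition expect (L : finType) (p : U -> L -> R) (F : (U -> L) -> R) : R :=
  \sum_(a : {ffun U -> L}) weight p a * F a.

Definition is_pmf (L : finType) (q : L -> R) :=
  (forall t, 0 <= q t) /\ \sum_t q t = 1.

Lemma expect_ext (L : finType) (p : U -> L -> R) (F H : (U -> L) -> R) :
  (forall a : {ffun U -> L}, F a = H a) -> expect p F = expect p H.
Proof. by move=> FH; rewrite /expect; apply: eq_bigr => a _; rewrite FH. Qed.

Lemma expect_ext_pmf (L : finType) (p q : U -> L -> R) F :
  (forall u, p u =1 q u) -> expect p F = expect q F.
Proof.
move=> pq; rewrite /expect; apply: eq_bigr => a _; congr (_ * _).
by apply: eq_bigr => u _; rewrite pq.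
Qed.

Lemma expect_supp (L : finType) (p : U -> L -> R) (F H : (U -> L) -> R) :
  (forall a : {ffun U -> L}, (forall u, p u (a u) != 0) -> F a = H a) ->
  expect p F = expect p H.
Proof.
move=> FH; rewrite /expect; apply: eq_bigr => a _.
have [/forallP pa0|/forallPn[u /negPn/eqP pu0]] := boolP [forall u, p u (a u) != 0].
  by rewrite FH.
by rewrite /weight (bigD1 u)//= pu0 !mul0r.
Qed.

Lemma expect1 (L : finType) (p : U -> L -> R) :
  (forall u, \sum_t p u t = 1) -> expect p (fun=> 1) = 1.
Proof.
move=> p1; rewrite /expect; under eq_bigr do rewrite mulr1.
by rewrite -(bigA_distr_bigA p) big1.
Qed.

(** Label vectors are grouped by their image; by distributivity the product of the fibre sums is the
    weight of a whole group. [F_ext] bridges finite functions and plain ones. *)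
Lemma expect_push (L L' : finType) (c : U -> L -> L') (p : U -> L -> R) F
    (F_ext : forall a b : U -> L', a =1 b -> F a = F b) :
  expect (fun u i => \sum_(t | c u t == i) p u t) F =
  expect p (fun a => F (fun u => c u (a u))).
Proof.
rewrite /expect (partition_big (fun a : {ffun U -> L} => [ffun u => c u (a u)])
  predT)//=.
apply: eq_bigr => b _; rewrite /weight bigA_distr_big_dep mulr_suml.
apply: eq_big => [a|a /familyP ab]; last first.
  congr (_ * _); apply: F_ext => u.
  by have := ab u; rewrite unfold_in => /eqP ->.
apply/familyP/eqP => [ab|<- u].
  by apply/ffunP => u; rewrite ffunE; have := ab u; rewrite unfold_in => /eqP.
by rewrite unfold_in ffunE.
Qed.

(* Swapping the [K]-coordinates of two independent copies of the labels is a
   weight-preserving involution. *)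
Lemma expect_indep (L : finType) (p : U -> L -> R) (K : {pred U})
    (F H : (U -> L) -> R) :
  (forall u, \sum_t p u t = 1) ->
  depends_on (fun u => u \in K) F ->
  depends_on (fun u => u \notin K) H ->
  expect p (fun a => F a * H a) = expect p F * expect p H.
Proof.
move=> p1 dF dH.
rewrite -[LHS]mulr1 -(expect1 p1) /expect !big_distrlr/= !pair_bigA/=.
pose sw (z : {ffun U -> L} * {ffun U -> L}) :=
  ([ffun u => if u \in K then z.1 u else z.2 u],
   [ffun u => if u \in K then z.2 u else z.1 u]) : {ffun U -> L} * {ffun U -> L}.
have swK : involutive sw.
  by move=> [a b]; congr pair; apply/ffunP => u; rewrite !ffunE /= ?ffunE;
    case: ifP => ->.
rewrite [RHS](reindex_inj (inv_inj swK)); apply: eq_bigr => -[a b] _ /=.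
rewrite mulr1 mulrAC [RHS]mulrACA /weight -!big_split/=.
have -> : F [ffun u => if u \in K then a u else b u] = F a.
  by apply: dF => u uK; rewrite ffunE uK.
have -> : H [ffun u => if u \in K then b u else a u] = H a.
  by apply: dH => u uK; rewrite ffunE (negPf uK).
congr (_ * _); apply: eq_bigr => u _; rewrite !ffunE.
by case: ifP => //; rewrite mulrC.
Qed.

Definition upd (L : finType) (p : U -> L -> R) (u : U) (q : L -> R) : U -> L -> R :=
  fun u' => if u' == u then q else p u'.

(** Linearity in the distribution of one coordinate; the values at point masses are the generators
    of the conic combination used later. *)
Lemma expect_upd (L : finType) (p : U -> L -> R) u q F :
  expect (upd p u q) F =
  \sum_t q t * expect (upd p u (fun s => (s == t)%:R)) F.
Proof.
rewrite /expect; under [RHS]eq_bigr do rewrite big_distrr/=.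
rewrite exchange_big/=; apply: eq_bigr => a _.
have wE q' : weight (upd p u q') a = q' (a u) * \prod_(i | i != u) p i (a i).
  rewrite /weight (bigD1 u)//= {1}/upd eqxx; congr (_ * _).
  by apply: eq_bigr => i iu; rewrite /upd (negPf iu).
rewrite wE (bigD1 (a u))//= wE eqxx mul1r [X in _ = _ + X]big1 ?addr0 ?mulrA//.
by move=> t tau; rewrite wE eq_sym (negPf tau) !mul0r mulr0.
Qed.

(** By [expect_upd] a point mass at [u] suffices. It is the image of [p u] under a constant
    recoding, which [F] cannot see. *)
Lemma expect_upd_indep (L : finType) (p : U -> L -> R) u q F :
  \sum_t p u t = 1 -> \sum_t q t = 1 ->
  depends_on (fun i => i != u) F ->
  expect (upd p u q) F = expect p F.
Proof.
move=> p1 q1 dF; rewrite expect_upd.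
suff E t : expect (upd p u (fun s => (s == t)%:R)) F = expect p F.
  by under eq_bigr do rewrite E; rewrite -mulr_suml q1 mul1r.
pose c (i : U) (s : L) := if i == u then t else s.
rewrite -[RHS](@expect_ext _ p (fun a => F (fun i => c i (a i)))); last first.
  by move=> a; apply: dF => i iu; rewrite /c (negPf iu).
rewrite -expect_push; last by move=> a b ab; apply: dF => i _; rewrite ab.
apply: expect_ext_pmf => i s; rewrite /upd /c; case: eqP => [->|_].
  by rewrite eq_sym; case: eqP => _; [rewrite p1|rewrite big_pred0_eq].
by rewrite big_pred1_eq.
Qed.

End ProductExpectation.

(** * Caratheodory's theorem for cones *)

Section Caratheodory.
Variable R : realFieldType.

(** Induction on the size of the support. If it exceeds [#|D|], the vectors [h t] restricted to [D]
    are linearly dependent over the support, and moving [p] along a dependency makes some weight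
    vanish. *)
Lemma conic_caratheodory (T J : finType) (D : {pred J}) (h : T -> J -> R)
    (p : T -> R) : (forall t, 0 <= p t) ->
  exists q : T -> R, [/\ forall t, 0 <= q t,
    (#|[pred t | q t != 0%R]| <= #|D|)%N &
    forall j, j \in D -> \sum_t q t * h t j = \sum_t p t * h t j].
Proof.
have [m] := ubnP #|[pred t | p t != 0]|.
elim: m p => // m IH p mp p0.
have [le|lt] := leqP #|[pred t | p t != 0]| #|D|; first by exists p.
pose S := [pred t | p t != 0].
pose H : 'M[R]_(#|S|, #|D|) := \matrix_(i, j) h (enum_val i) (enum_val j).
have : kermx H != 0.
  rewrite kermx_eq0 /row_free neq_ltn; apply/orP; left.
  by apply: leq_ltn_trans lt; exact: rank_leq_col.
case/rowV0Pn => v /sub_kermxP vH v0.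
have [c [cS cH [t0 ct0]]] : exists c : T -> R,
    [/\ forall t, t \notin S -> c t = 0,
        forall j, j \in D -> \sum_t c t * h t j = 0 & exists t, 0 < c t].
  (* The sign is chosen so that some coefficient is positive; otherwise no weight need decrease
     along the move. *)
  have [w [wH [i wi]]] : exists w : 'rV[R]_#|S|, w *m H = 0 /\ exists i, 0 < w 0 i.
    have [i vi] : exists i, v 0 i != 0.
      apply/existsP; rewrite -negb_forall; apply: contra v0 => /forallP v0.
      by apply/eqP/rowP => i; rewrite mxE (eqP (v0 i)).
    have [vpos|vneg] := ltP 0 (v 0 i); first by exists v; split=> //; exists i.
    exists (- v); rewrite mulNmx vH oppr0; split=> //.
    by exists i; rewrite mxE oppr_gt0 lt_neqAle vi.
  pose c t := if @idP (t \in S) is ReflectT tS then w 0 (enum_rank_in tS t) else 0.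
  have cE k : c (enum_val k) = w 0 k.
    rewrite /c; case: {-}_ / idP => [kS|]; last by case; exact: enum_valP.
    by rewrite enum_valK_in.
  have c0 t : t \notin S -> c t = 0.
    by move=> tS; rewrite /c; case: {-}_ / idP => // tS'; rewrite tS' in tS.
  exists c; split=> // [j jD|]; last by exists (enum_val i); rewrite cE.
  rewrite (bigID (fun t => t \in S))/= [X in _ + X]big1 ?addr0; last first.
    by move=> t tS; rewrite c0// mul0r.
  rewrite big_enum_val/=.
  have := congr1 (fun M : 'rV[R]_#|D| => M 0 (enum_rank_in jD j)) wH.
  rewrite !mxE => wj; rewrite -[RHS]wj; apply: eq_bigr => k _.
  by rewrite cE mxE enum_rankK_in.
(* The smallest ratio is the longest step that keeps all weights nonnegative, and it cancels the
   weight of [t1]. *)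
have [t1 ct1 t1min] : exists2 t1, 0 < c t1 &
    forall t, 0 < c t -> p t1 / c t1 <= p t / c t.
  case: (@arg_minP _ _ _ t0 (fun t => 0 < c t) (fun t => p t / c t) ct0).
  by move=> t1 ct1 t1min; exists t1.
pose lam := p t1 / c t1.
pose q t := p t - lam * c t.
have lam0 : 0 <= lam by rewrite divr_ge0// ltW.
have q0 t : 0 <= q t.
  rewrite /q subr_ge0; have [ct|ct] := ltP 0 (c t).
    by rewrite -ler_pdivlMr// t1min.
  by rewrite (le_trans _ (p0 t))// mulr_ge0_le0.
have qt1 : q t1 = 0 by rewrite /q /lam divfK ?subrr// gt_eqF.
have St1 : t1 \in S.
  by apply: contraT => /cS ct; rewrite ct ltxx in ct1.
have [||r [r0 rD rH]] := IH q; [|exact: q0|].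
  rewrite -ltnS; apply: leq_trans mp; rewrite ltnS; apply: proper_card.
  apply/properP; split; last by exists t1 => //; rewrite inE qt1 eqxx.
  apply/fintype.subsetP => t; rewrite inE; apply: contraR => tS.
  by rewrite /q cS// mulr0 subr0; move: tS; rewrite inE negbK.
exists r; split=> // j jD; rewrite rH// /q.
under eq_bigr do rewrite mulrBl -mulrA.
by rewrite sumrB -mulr_sumr cH// mulr0 subr0.
Qed.

End Caratheodory.

(** * Reducing the supports in a finite model *)

Section FiniteReduction.
Variables (R : realFieldType) (G : dag) (S : dV G -> finType).

(** The probability that every [g v] takes the value [rho v], written as a product of indicators so
    that it splits over a set of nodes and its complement. *)
Definition law (L : finType) (p : dU G -> L -> R)
    (g : forall v, (dU G -> L) -> S v) (rho : {dffun forall v, S v}) : R :=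
  expect p (fun a => \prod_v (g v a == rho v)%:R).

(** When [S v] is the type of response functions of [v], this is [can_card]. *)
Definition component_size (u : dU G) : nat := (\prod_(v in Cset G u) #|S v|)%N.

(** All exogenous parents of [v] are linked through their common child [v], so any one of them
    decides the membership of [v]. *)
Lemma Cset_ex (u u' : dU G) v : u' \in ex G v ->
  (v \in Cset G u) = connect (cchild G) u u'.
Proof.
move=> u'v; rewrite inE; apply/existsP/idP => [[w /andP[uw wv]]|uu']; last first.
  by exists u'; rewrite uu'.
apply: connect_trans uw (connect1 _).
by apply/existsP; exists v; rewrite wv.
Qed.

Lemma is_pmf_inhabited (L : finType) (q : L -> R) : is_pmf q -> exists t, q t != 0.
Proof.
move=> [_ q1]; apply/existsP; rewrite -negb_forall; apply/negP => /forallP q0.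
by move: q1; rewrite big1 => [/esym/eqP|t _]; [rewrite oner_eq0|exact/eqP/q0].
Qed.

Lemma reduce_support_at (L : finType) (p : dU G -> L -> R)
    (g : forall v, (dU G -> L) -> S v) (rho0 : {dffun forall v, S v}) (u : dU G) :
  (forall i, is_pmf (p i)) ->
  (forall v, depends_on (fun i => i \in ex G v) (g v)) ->
  exists q : L -> R, [/\ is_pmf q,
    (#|[pred t | q t != 0%R]| <= component_size u)%N &
    forall rho, law (upd p u q) g rho = law p g rho].
Proof.
move=> ppmf dg.
(* [F] collects the responses driven by the component of [u], [H] the others. *)
pose C := Cset G u; pose K := [pred i | connect (cchild G) u i].
pose F (rho : {dffun forall v, S v}) (a : dU G -> L) : R :=
  \prod_(v in C) (g v a == rho v)%:R.
pose H (rho : {dffun forall v, S v}) (a : dU G -> L) : R :=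
  \prod_(v | v \notin C) (g v a == rho v)%:R.
have dF rho : depends_on (fun i => i \in K) (F rho).
  move=> a b ab; apply: eq_bigr => v vC; congr (_ == _)%:R; apply: dg => i iv.
  by apply: ab; rewrite inE -(Cset_ex _ iv).
have dH rho : depends_on (fun i => i \notin K) (H rho).
  move=> a b ab; apply: eq_bigr => v vC; congr (_ == _)%:R; apply: dg => i iv.
  by apply: ab; rewrite inE -(Cset_ex _ iv).
have uK : u \in K by rewrite inE.
have lawE q rho : (forall i, is_pmf (q i)) ->
    law q g rho = expect q (F rho) * expect q (H rho).
  move=> qpmf; rewrite -(@expect_indep _ _ _ _ K)//; last by move=> i; case: (qpmf i).
  by apply: expect_ext => a; rewrite (bigID (fun v => v \in C)).
(* Outside [C] the coordinates are frozen at [rho0], so [D] has exactly [component_size u]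
   points. *)
pose D : {pred {dffun forall v, S v}} :=
  family (fun v => if v \in C then predT else pred1 (rho0 v)).
pose delta (t s : L) : R := (s == t)%:R.
have delta1 t : \sum_s delta t s = 1.
  rewrite /delta (bigD1 t)//= eqxx big1 ?addr0// => s st.
  by rewrite (negPf st).
pose h t rho := expect (upd p u (delta t)) (F rho).
have [q [q0 qsupp qh]] := conic_caratheodory D h (proj1 (ppmf u)).
have upd1 q' : \sum_t q' t = 1 -> forall i, \sum_t upd p u q' i t = 1.
  by move=> q1 i; rewrite /upd; case: eqP => // _; case: (ppmf i).
(* Each label vector matches exactly one [rho] in [D]. Hence the total mass is a sum of the
   preserved quantities and costs no extra equation, which keeps the bound at [component_size u]
   instead of one more. *)
have hsum t : \sum_(rho in D) h t rho = 1.
  rewrite /h /expect exchange_big/= -[RHS](expect1 (upd1 _ (delta1 t))).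
  apply: eq_bigr => a _; rewrite -mulr_sumr; congr (_ * _).
  pose ra : {dffun forall v, S v} := [ffun v => if v \in C then g v a else rho0 v].
  have raD : ra \in D.
    apply/familyP => v; rewrite ffunE.
    by case: ifP => // _; rewrite inE.
  rewrite (bigD1 ra)//= {1}/F big1 => [|v vC]; last by rewrite ffunE vC eqxx.
  rewrite big1 ?addr0// => rho /andP[/familyP rhoD rhora].
  have [v /andP[vC gv]|rhoC] := pickP [pred v | (v \in C) && (g v a != rho v)].
    by rewrite /F (bigD1 v)//= (negPf gv) mul0r.
  case/eqP: rhora; apply/ffunP => v; rewrite ffunE; have := rhoD v.
  case: ifP => [vC _|_]; last by rewrite inE => /eqP.
  by have := rhoC v; rewrite inE/= vC => /negbFE/eqP.
have q1 : \sum_t q t = 1.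
  have tot (q' : L -> R) : \sum_t q' t = \sum_(rho in D) \sum_t q' t * h t rho.
    rewrite exchange_big/=; apply: eq_bigr => t _.
    by rewrite -mulr_sumr hsum mulr1.
  by rewrite tot (eq_bigr _ qh) -tot; case: (ppmf u).
have qpmf i : is_pmf (upd p u q i) by rewrite /upd; case: eqP.
exists q; split=> // [|rho].
  apply: leq_trans qsupp _; rewrite card_family foldrE big_map big_enum/=.
  rewrite /component_size [leqRHS]big_mkcond/= leq_prod// => v _.
  by case: ifP => _; rewrite ?cardT// ?card1.
rewrite !lawE//; congr (_ * _); last first.
  apply: expect_upd_indep => //; first by case: (ppmf u).
  move=> a b ab; apply: dH => i iK; apply: ab; apply: contraNneq iK => ->.
  exact: uK.
pose rho' : {dffun forall v, S v} := [ffun v => if v \in C then rho v else rho0 v].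
have rhoD : rho' \in D.
  by apply/familyP => v; rewrite ffunE; case: ifP => // _; rewrite inE.
have -> : F rho = F rho'.
  by apply/funext => a; apply: eq_bigr => v vC; rewrite ffunE vC.
rewrite expect_upd qh// /h -expect_upd; apply: expect_ext_pmf => i t.
by rewrite /upd; case: eqP => // ->.
Qed.

Lemma reduce_support (L : finType) (p : dU G -> L -> R)
    (g : forall v, (dU G -> L) -> S v) (rho0 : {dffun forall v, S v}) :
  (forall u, is_pmf (p u)) ->
  (forall v, depends_on (fun i => i \in ex G v) (g v)) ->
  exists q : dU G -> L -> R, [/\ forall u, is_pmf (q u),
    forall u, (#|[pred t | q u t != 0%R]| <= component_size u)%N &
    forall rho, law q g rho = law p g rho].
Proof.
move=> ppmf dg.
(* Generalised to the list of nodes already treated: changing the distribution of one node leaves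
   the supports at the others alone. *)
suff [q [qpmf qs ql]] : exists q : dU G -> L -> R, [/\ forall u, is_pmf (q u),
    forall u, u \in enum (dU G) ->
      (#|[pred t | q u t != 0%R]| <= component_size u)%N &
    forall rho, law q g rho = law p g rho].
  by exists q; split=> // u; apply: qs; rewrite mem_enum.
elim: (enum (dU G)) => [|u s [q [qpmf qs ql]]]; first by exists p.
have [r [rpmf rs rl]] := reduce_support_at rho0 u qpmf dg.
exists (upd q u r); split=> [i|i|rho]; last by rewrite rl.
  by rewrite /upd; case: eqP.
rewrite /upd inE; case: eqP => [->|_] //; exact: qs.
Qed.

Lemma canonical_labels (L : finType) (p : dU G -> L -> R)
    (g : forall v, (dU G -> L) -> S v) (rho0 : {dffun forall v, S v}) (N : nat) :
  (forall u, (component_size u <= N.+1)%N) ->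
  (forall u, is_pmf (p u)) ->
  (forall v, depends_on (fun i => i \in ex G v) (g v)) ->
  exists (q : dU G -> 'I_N.+1 -> R) (g' : forall v, (dU G -> 'I_N.+1) -> S v),
   [/\ forall u, is_pmf (q u),
    forall u (i : 'I_N.+1), (component_size u <= i)%N -> q u i = 0,
    forall v, depends_on (fun i => i \in ex G v) (g' v) &
    forall rho, law q g' rho = law p g rho].
Proof.
move=> sizeN ppmf dg; have [q [qpmf qs ql]] := reduce_support rho0 ppmf dg.
have [t0 _] := choice (fun u => is_pmf_inhabited (qpmf u)).
pose s u := enum [pred t | q u t != 0].
have sE u t : (t \in s u) = (q u t != 0) by rewrite mem_enum inE.
have s_size u : (size (s u) <= component_size u)%N by rewrite -cardE; exact: qs.
(* Labels are numbered by their position in the support. Those off the support may get any number,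
   since they carry no weight. *)
pose c u t : 'I_N.+1 := inord (index t (s u)).
pose e u (i : 'I_N.+1) := nth (t0 u) (s u) i.
have cE u t : q u t != 0 -> c u t = index t (s u) :> nat.
  rewrite -sE -index_mem => ts; rewrite inordK//.
  by apply: leq_trans ts _; apply: leq_trans (s_size u) (sizeN u).
have eK u t : q u t != 0 -> e u (c u t) = t.
  by move=> qt; rewrite /e cE// nth_index// sE.
exists (fun u i => \sum_(t | c u t == i) q u t).
exists (fun v b => g v (fun u => e u (b u))); split=> [u|u i ui|v a b ab|rho].
- split=> [i|]; first by apply: sumr_ge0 => t _; case: (qpmf u).
  by rewrite -(proj2 (qpmf u)) [RHS](partition_big (c u) predT).
- apply: big1 => t /eqP cti; apply/eqP; apply: contraT => qt.
  move: ui; rewrite -cti cE// leqNgt => /negP; case.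
  by apply: leq_trans (s_size u); rewrite index_mem sE.
- by apply: dg => i iv; rewrite ab.
rewrite -ql /law
  (@expect_push _ _ _ _ c q
    (fun b => \prod_v (g v (fun u => e u (b u)) == rho v)%:R)).
  apply: expect_supp => a qa; apply: eq_bigr => v _; congr (_ == _)%:R.
  by apply: dg => u _; rewrite eK.
move=> a b ab; apply: eq_bigr => v _; congr (_ == _)%:R.
by apply: dg => u _; rewrite ab.
Qed.

End FiniteReduction.

(** * Approximation by finite models *)

Section FiniteProbability.
Variables (R : realType) (d : measure_display) (T : measurableType d).
Variable P : probability T R.

Definition prob (A : set T) : R := fine (P A).

Lemma probE A : measurable A -> P A = (prob A)%:E.
Proof. by move=> mA; rewrite /prob fineK// fin_num_measure. Qed.

Lemma prob_ge0 A : 0 <= prob A.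
Proof. exact/fine_ge0/measure_ge0. Qed.

Lemma prob0 : prob set0 = 0.
Proof. by rewrite /prob measure0. Qed.

Lemma prob_setT : prob setT = 1.
Proof. by rewrite /prob probability_setT. Qed.

Lemma fsum_finType (V : nmodType) (I : finType) (F : I -> V) :
  (\sum_(i \in [set: I]) F i)%R = (\sum_i F i)%R.
Proof.
rewrite (fsbigE (index_enum I)) ?index_enum_uniq//; last first.
  by move=> i _; rewrite mem_index_enum.
by apply: eq_bigl => i; rewrite in_setT.
Qed.

Lemma prob_le_sum (I : finType) (A : set T) (B : I -> set T) :
  measurable A -> (forall i, measurable (B i)) ->
  A `<=` \bigcup_i B i -> prob A <= \sum_i prob (B i).
Proof.
move=> mA mB AB.
have : (P A <= \sum_i P (B i))%E.
  by rewrite -fsum_finType; apply: content_sub_fsum AB => //; exact: finite_finset.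
rewrite probE//; under eq_bigr do rewrite probE//.
by rewrite sumEFin lee_fin.
Qed.

Lemma prob_discrete (J : finType) (X : T -> J) (Q : pred J) :
  (forall j, measurable (X @^-1` [set j])) ->
  prob [set o | Q (X o)] = \sum_j prob (X @^-1` [set j]) * (Q j)%:R.
Proof.
move=> mX; pose F j := if Q j then X @^-1` [set j] else set0.
have mF j : measurable (F j).
  by rewrite /F; case: ifP => _; [exact: mX|exact: measurable0].
have -> : [set o | Q (X o)] = \bigcup_j F j.
  apply/seteqP; split=> [o /= Qo|o [j _]]; first by exists (X o) => //; rewrite /F Qo.
  by rewrite /F; case: ifP => //= Qj ->.
have -> : prob (\bigcup_j F j) = \sum_j prob (F j).
  apply: EFin_inj; rewrite -sumEFin -probE; last first.
    by apply: fin_bigcup_measurable => //; exact: finite_finset.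
  under eq_bigr do rewrite -probE//.
  rewrite -fsum_finType; apply: measure_fin_bigcup => //; first exact: finite_finset.
  apply/trivIsetP => i j _ _ ij; apply/seteqP; split=> // o [].
  rewrite /F; case: ifP => // _; case: ifP => //= _ Xi Xj.
  by rewrite -Xi -Xj eqxx in ij.
apply: eq_bigr => j _; rewrite /F.
by case: (Q j); rewrite ?mulr1 ?mulr0 ?prob0.
Qed.

Lemma prob_diff A B : measurable A -> measurable B ->
  `|prob A - prob B| <= prob (A `+` B).
Proof.
move=> mA mB; have mAB : measurable (A `+` B).
  by apply: measurableU; exact: measurableD.
have half A' B' : measurable A' -> measurable B' -> A' `+` B' = A `+` B ->
    prob A' <= prob (A `+` B) + prob B'.
  move=> mA' mB' AB'.
  have := @prob_le_sum bool A' (fun b => if b then A `+` B else B') mA'.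
  rewrite big_bool; apply=> [[]//|o A'o].
  have [B'o|nB'o] := pselect (B' o); first by exists false.
  by exists true => //; change ((A `+` B) o); rewrite -AB'; left.
rewrite ler_norml lerBDl; apply/andP; split; last by rewrite lerBlDr half.
by rewrite lerBlDr addrC half// setYC.
Qed.

End FiniteProbability.

(** * Approximation of events by finite codes *)

Section Discretisation.
Variables (R : realType) (d : measure_display) (T : measurableType d).
Variables (P : probability T R) (U : finType) (dU : U -> measure_display).
Variables (W : forall u, measurableType (dU u)) (X : forall u, T -> W u).
Hypothesis mX : forall u, measurable_fun setT (X u).

Record coded_event := CodedEvent {
  ce_label : finType;
  ce_code : forall u, W u -> ce_label;
  ce_test : (U -> ce_label) -> bool
}.

Definition coded (L : finType) (c : forall u, W u -> L) (o : T) : U -> L :=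
  fun u => c u (X u o).

Definition measurable_code (L : finType) (c : forall u, W u -> L) :=
  forall u l, measurable (c u @^-1` [set l]).

Lemma measurable_coded_eq (L : finType) (c : forall u, W u -> L) (a : U -> L) :
  measurable_code c -> measurable [set o | coded c o = a].
Proof.
move=> mc.
have -> : [set o | coded c o = a] =
    \bigcap_(u in [set: U]) (X u @^-1` (c u @^-1` [set a u])).
  apply/seteqP; split=> [o /= <-//|o oa]; apply/funext => u; exact: oa.
apply: fin_bigcap_measurable => [|u _]; first exact: finite_finset.
by rewrite -[X in measurable X]setTI; apply: mX.
Qed.

Lemma measurable_coded (L : finType) (c : forall u, W u -> L) (Q : (U -> L) -> Prop) :
  measurable_code c -> measurable [set o | Q (coded c o)].
Proof.
move=> mc.
have -> : [set o | Q (coded c o)] =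
    \bigcup_(a in [set a : {ffun U -> L} | Q a]) [set o | coded c o = a].
  apply/seteqP; split=> [o /= Qo|o [a /= Qa ->]]//.
  have E : coded c o = [ffun u => coded c o u].
    by apply/funext => u; rewrite ffunE.
  by exists [ffun u => coded c o u] => /=; rewrite -E.
apply: fin_bigcup_measurable => [|a _]; first exact: finite_finset.
exact: measurable_coded_eq.
Qed.

(** Confining the test to [E] is what lets the finite models respect the diagram. *)
Definition approximable (E : {set U}) (A : set T) :=
  measurable A /\ forall e : R, 0 < e -> exists Y : coded_event,
  [/\ measurable_code (@ce_code Y),
      depends_on (fun u => u \in E) (@ce_test Y) &
      prob P (A `+` [set o | ce_test (coded (@ce_code Y) o)]) < e].

(** The tuple of the individual codes serves as a common code. *)
Lemma approximable_family (I : finType) (E : I -> {set U}) (A : I -> set T) (e : R) :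
  (forall i, approximable (E i) (A i)) -> 0 < e ->
  exists (L : finType) (c : forall u, W u -> L) (S : I -> (U -> L) -> bool),
  [/\ measurable_code c, forall i, depends_on (fun u => u \in E i) (S i) &
      forall i, prob P (A i `+` [set o | S i (coded c o)]) < e].
Proof.
move=> AE e0.
have [Y YP] := choice (fun i => proj2 (AE i) e e0).
pose c u (w : W u) : {dffun forall i : I, ce_label (Y i)} :=
  [ffun i => ce_code (Y i) w].
exists {dffun forall i : I, ce_label (Y i)}, c.
exists (fun i (a : U -> {dffun forall i : I, ce_label (Y i)}) =>
  @ce_test (Y i) (fun u => a u i)); split=> [u l|i a b ab|i].
- have -> : c u @^-1` [set l] =
      \bigcap_(i in [set: I]) (@ce_code (Y i) u @^-1` [set l i]).
    apply/seteqP; split=> [w /= <- i _|w wl]; first by rewrite /= ffunE.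
    by apply/ffunP => i; rewrite ffunE; exact: wl.
  apply: fin_bigcap_measurable => [|i _]; first exact: finite_finset.
  by case: (YP i) => + _ _; exact.
- by case: (YP i) => _ dY _; apply: dY => u uE; rewrite ab.
case: (YP i) => _ _; congr (prob _ (_ `+` _) < _).
apply/funext => o /=; congr (is_true (ce_test _)); apply/funext => u.
by rewrite /coded ffunE.
Qed.

(** The approximable events form a sigma-algebra containing the generators. For a countable union,
    continuity from below leaves finitely many events, which are approximated through a common
    code. *)
Lemma approximable_sigma (E : {set U}) (A : set T) :
  <<s \bigcup_(u in [set u | u \in E])
    [set X u @^-1` B | B in [set B : set (W u) | measurable B]] >> A ->
  approximable E A.
Proof.
move: A; apply: smallest_sub; last first.
  move=> _ [u uE [B mB <-]]; split=> [|e e0].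
    by rewrite -[X in measurable X]setTI; apply: mX.
  (* A code is needed at every exogenous variable; away from [u] it is constant, coming from the
     empty set. *)
  pose B' := @dfwith U (fun u => set (W u)) (fun=> set0) u B.
  exists (CodedEvent (fun u w => `[< B' u w >]) (fun a => a u)); split=> /=.
  - move=> i l; have mB' : measurable (B' i).
      by rewrite /B'; case: dfwithP => // *; exact: measurable0.
    case: l.
      rewrite (_ : _ @^-1` _ = B' i)//.
      by apply/seteqP; split=> w /=; [move/asboolP|move=> ?; exact/asboolP].
    rewrite (_ : _ @^-1` _ = ~` B' i); first exact: measurableC.
    apply/seteqP; split=> w /=; first by move/negbT/asboolPn.
    by move=> ?; exact/negbTE/asboolPn.
  - by move=> a b; apply.
  rewrite (_ : [set o | _] = X u @^-1` B) ?setYK ?prob0//.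
  by apply/seteqP; split=> o /=; rewrite /coded /B' dfwithin;
    [move/asboolP|move=> ?; exact/asboolP].
split.
- split=> [|e e0]; first exact: measurable0.
  exists (CodedEvent (fun u (_ : W u) => tt) (fun=> false)); split=> /=.
  + by move=> u []; rewrite (_ : _ @^-1` _ = setT)//; apply/seteqP; split.
  + by move=> a b.
  by rewrite (_ : [set o | _] = set0) ?setYK ?prob0//; apply/seteqP; split.
- move=> A [mA AE]; split=> [|e e0]; first by rewrite setTD; exact: measurableC.
  have [[L c S] [mc dS PS]] := AE e e0.
  exists (CodedEvent c (fun a => ~~ S a)); split=> //=.
    by move=> a b ab; congr (~~ _); exact: dS.
  (* Complementing both sets does not change their symmetric difference. *)
  suff -> : [set: T] `\` A `+` [set o | ~~ S (coded c o)] =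
    A `+` [set o | S (coded c o)] by [].
  have t : is_true true by [].
  have f : ~ is_true false by [].
  apply/seteqP; split=> o /=; rewrite /setY /setD /setU /mkset;
  by case: (S _); have [Ao|nA] := pselect (A o); rewrite /=; tauto.
move=> A AE; have mA n : measurable (A n) by case: (AE n).
split=> [|e e0]; first exact: bigcupT_measurable.
pose B n := \bigcup_(k < n) A k.
have mB n : measurable (B n) by apply: bigcup_measurable.
have mAU : measurable (\bigcup_k A k) by exact: bigcupT_measurable.
have [n PBn] : exists n, prob P ((\bigcup_k A k) `\` B n) < e / 2.
  have cvg : P \o B @ \oo --> P (\bigcup_n B n).
    apply: nondecreasing_cvg_mu => //; first exact: bigcupT_measurable.
    move=> m n mn; apply/subsetPset; apply: bigcup_sub => k /= km.
    by move=> o Ao; exists k => //=; exact: leq_trans mn.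
  have BA : \bigcup_n B n = \bigcup_k A k.
    apply/seteqP; split=> [o [n _ [k _ Ao]]|o [k _ Ao]]; first by exists k.
    by exists k.+1 => //; exists k => /=.
  have : fine \o (P \o B) @ \oo --> prob P (\bigcup_k A k).
    by apply: fine_cvg; rewrite -probE// -BA.
  move=> /cvgrPdist_lt/(_ (e / 2)).
  rewrite divr_gt0// => /(_ isT)[n _ /(_ n (leqnn n))/= nB].
  exists n; have BnA : B n `<=` \bigcup_k A k.
    by apply: bigcup_sub => k _ o Ao; exists k.
  apply: le_lt_trans nB.
  rewrite /prob measureD//; last by rewrite ltey_eq fin_num_measure.
  rewrite setIidr// fineB ?fin_num_measure//.
  exact: ler_norm.
(* Half of [e] pays for the tail and half is shared by [n] approximations; [n.+1] avoids a division
   by zero. *)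
have e20 : 0 < e / 2 / n.+1%:R by rewrite !divr_gt0.
have [L [c [S [mc dS PS]]]] := approximable_family (fun i : 'I_n => AE i) e20.
exists (CodedEvent c (fun a => [exists i, S i a])); split=> //=.
  move=> a b ab; apply/existsP/existsP => -[i Si]; exists i.
    by rewrite -(dS i a b ab).
  by rewrite (dS i a b ab).
have mS i : measurable (A (nat_of_ord i) `+` [set o | S i (coded c o)]).
  by apply: measurableU; apply: measurableD => //; exact: (measurable_coded (S i)).
(* [ord0] indexes the tail, [lift ord0 i] the error made on [A i]. *)
pose D (j : 'I_n.+1) :=
  if unlift ord0 j is Some i then A i `+` [set o | S i (coded c o)]
  else (\bigcup_k A k) `\` B n.
have mD i : measurable (D i).
  by rewrite /D; case: unliftP => *; [exact: mS|exact: measurableD].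
apply: le_lt_trans (prob_le_sum P _ mD _) _.
- by apply: measurableU; apply: measurableD => //;
    exact: (measurable_coded (fun a => [exists i, S i a])).
- move=> o [[Ao nS]|[/existsP[i Si] nA]].
    have [[k kn Ak]|nB] := pselect (B n o); last first.
      by exists ord0; rewrite // /D unlift_none.
    exists (lift ord0 (Ordinal kn)); rewrite // /D liftK; left; split=> //= Sk.
    by apply: nS; apply/existsP; exists (Ordinal kn).
  exists (lift ord0 i); rewrite // /D liftK; right; split=> // Ai; apply: nA.
  by exists i.
rewrite big_ord_recl /D unlift_none; under eq_bigr do rewrite liftK.
apply: lt_le_trans (_ : e / 2 + e / 2 <= e); last by rewrite -splitr.
apply: ltr_leD => //.
apply: le_trans (ler_sum _ (fun i _ => ltW (PS i))) _.
rewrite sumr_const card_ord -[leLHS]mulr_natr -(mulrA (e / 2)).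
rewrite ler_piMr ?(ltW (divr_gt0 _ _))//.
by rewrite mulrC ler_pdivrMr// mul1r ler_nat.
Qed.

End Discretisation.

(** * Approximation of the response law *)

Section ResponseApproximation.
Variables (R : realType) (G : dag) (S : dV G -> finType).
Variables (d : measure_display) (T : measurableType d) (P : probability T R).
Variables (dd : dU G -> measure_display) (W : forall u, measurableType (dd u)).
Variable X : forall u, T -> W u.
Hypothesis mX : forall u, measurable_fun setT (X u).
Hypothesis indepX : forall A : forall u, set (W u), (forall u, measurable (A u)) ->
  prob P (\bigcap_(u in [set: dU G]) (X u @^-1` A u)) =
  \prod_(u : dU G) prob P (X u @^-1` A u).

Definition code_pmf (L : finType) (c : forall u, W u -> L) (u : dU G) (l : L) : R :=
  prob P (X u @^-1` (c u @^-1` [set l])).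

Lemma code_pmfP (L : finType) (c : forall u, W u -> L) :
  measurable_code c -> forall u, is_pmf (code_pmf c u).
Proof.
move=> mc u; split=> [l|]; first exact: prob_ge0.
rewrite -(prob_setT P).
have mcX l : measurable ((fun o => c u (X u o)) @^-1` [set l]).
  by rewrite -[X in measurable X]setTI; apply: (mX (measurableT) (mc u l)).
have := prob_discrete P (fun=> true) mcX.
rewrite (_ : [set o | _] = setT); last by apply/seteqP; split.
by move=> ->; apply: eq_bigr => l _; rewrite mulr1.
Qed.

(** By independence the vector of codes is distributed with the product weight. *)
Lemma law_coded (L : finType) (c : forall u, W u -> L)
    (g : forall v, (dU G -> L) -> S v) (rho : {dffun forall v, S v}) :
  measurable_code c ->
  law (code_pmf c) g rho = prob P [set o | forall v, g v (coded X c o) = rho v].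
Proof.
move=> mc; pose Y o : {ffun dU G -> L} := [ffun u => coded X c o u].
have YE o : Y o = coded X c o :> (dU G -> L) by apply/funext => u; rewrite ffunE.
have YEa (a : {ffun dU G -> L}) : Y @^-1` [set a] = [set o | coded X c o = a].
  apply/seteqP; split=> o /= => [<-//|oa].
  by apply/ffunP => u; rewrite ffunE oa.
have mY a : measurable (Y @^-1` [set a]) by rewrite YEa; exact: measurable_coded_eq.
rewrite (_ : [set o | _] = [set o | [forall v, g v (Y o) == rho v]]); last first.
  apply/seteqP; split=> o /= => [go|/forallP go v].
    by apply/forallP => v; rewrite YE go.
  by rewrite -YE; exact/eqP.
rewrite (prob_discrete P (fun a : {ffun dU G -> L} => [forall v, g v a == rho v]) mY).
apply: eq_bigr => a _; congr (_ * _).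
  rewrite /weight -indepX; last by move=> u; exact: mc.
  congr prob; rewrite YEa; apply/seteqP; split=> [o oa /= |o /= <- //].
  by apply/funext => u; exact: oa.
have [/forallP ga|/forallPn[v /negPf gv]] := boolP [forall v, g v a == rho v].
  by rewrite big1// => v _; rewrite ga.
by rewrite (bigD1 v)//= gv mul0r.
Qed.

Lemma law_approx (r : forall v, T -> S v) (rho0 : {dffun forall v, S v}) (e : R) :
  (forall v y, approximable P X (ex G v) (r v @^-1` [set y])) -> 0 < e ->
  exists (L : finType) (p : dU G -> L -> R) (g : forall v, (dU G -> L) -> S v),
  [/\ forall u, is_pmf (p u),
      forall v, depends_on (fun u => u \in ex G v) (g v) &
      forall rho, `|law p g rho - prob P [set o | forall v, r v o = rho v]| <= e].
Proof.
move=> rA e0; pose I := {v : dV G & S v}.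
have e1 : 0 < e / #|{: I}|.+1%:R by rewrite divr_gt0.
have [L [c [Q [mc dQ PQ]]]] := approximable_family (fun i : I =>
  rA (tag i) (tagged i)) e1.
(* Off the error events exactly one test at [v] succeeds, that of the true value [r v o]. The
   default [rho0 v] serves label vectors on which every test fails. *)
pose g v a : S v := odflt (rho0 v) [pick y | Q (Tagged S y) a].
exists L, (code_pmf c), g; split=> [|v a b ab|rho]; first exact: code_pmfP.
  rewrite /g; congr odflt; apply: eq_pick => y.
  by apply: (dQ (Tagged S y)).
have mr : measurable [set o | forall v, r v o = rho v].
  rewrite (_ : [set o | _] = \bigcap_(v in [set: dV G]) (r v @^-1` [set rho v])).
    apply: fin_bigcap_measurable => [|v _]; first exact: finite_finset.
    by case: (rA v (rho v)).
  by apply/seteqP; split=> [o ro v _|o ro v]; [exact: ro|exact: (ro v)].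
have mg : measurable [set o | forall v, g v (coded X c o) = rho v].
  exact: (measurable_coded mX (fun a => forall v, g v a = rho v)).
rewrite law_coded//; apply: le_trans (prob_diff P mg mr) _.
have mD (i : I) :
    measurable (r (tag i) @^-1` [set tagged i] `+` [set o | Q i (coded X c o)]).
  have mri : measurable (r (tag i) @^-1` [set tagged i]).
    by case: (rA (tag i) (tagged i)).
  by apply: measurableU; apply: measurableD => //; exact: (measurable_coded mX (Q i)).
apply: le_trans (prob_le_sum P _ mD _) _.
- by apply: measurableU; exact: measurableD.
- have key o : (forall i : I, ~ (r (tag i) @^-1` [set tagged i] `+`
      [set o | Q i (coded X c o)]) o) -> forall v, g v (coded X c o) = r v o.
    move=> nD v.
    have QE y : Q (Tagged S y) (coded X c o) <-> r v o = y.
      have nDy := nD (Tagged S y); split=> [Qy|ry].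
        by apply: contrapT => ry; apply: nDy; right.
      by apply: contrapT => nQ; apply: nDy; left.
    rewrite /g; case: pickP => [y /QE//|/(_ (r v o))].
    by have /QE -> := erefl (r v o).
  move=> o od; apply: contrapT => nD.
  have {}nD i : ~ (r (tag i) @^-1` [set tagged i] `+` [set o | Q i (coded X c o)]) o.
    by move=> iD; apply: nD; exists i.
  case: od => -[/= gr nr]; apply: nr => v; first by rewrite -key.
  by rewrite key.
apply: le_trans (ler_sum _ (fun i _ => ltW (PQ i))) _.
rewrite sumr_const -[leLHS]mulr_natr -mulrA ler_piMr ?(ltW e0)//.
by rewrite mulrC ler_pdivrMr// mul1r ler_nat.
Qed.

End ResponseApproximation.

(** * Existence of an exact limit law *)

Section Compactness.
Variables (R : realType) (G : dag) (S : dV G -> finType) (N : nat).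

Let n := #|{: dU G * 'I_N.+1}|.
Let point (x : 'rV[R]_n) (u : dU G) (i : 'I_N.+1) : R := x ord0 (enum_rank (u, i)).

(** Instead of extracting a subsequence, the proof uses a continuous nonnegative penalty: its values
    form a closed set with 0 as a limit, so 0 is attained. *)
Lemma law_closed (mu : {dffun forall v, S v} -> R) :
  (forall e : R, 0 < e ->
    exists (q : dU G -> 'I_N.+1 -> R) (g : forall v, (dU G -> 'I_N.+1) -> S v),
    [/\ forall u, is_pmf (q u),
        forall u (i : 'I_N.+1), (component_size S u <= i)%N -> q u i = 0,
        forall v, depends_on (fun i => i \in ex G v) (g v) &
        forall rho, `|law q g rho - mu rho| <= e]) ->
  exists (q : dU G -> 'I_N.+1 -> R) (g : forall v, (dU G -> 'I_N.+1) -> S v),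
  [/\ forall u, is_pmf (q u),
      forall u (i : 'I_N.+1), (component_size S u <= i)%N -> q u i = 0,
      forall v, depends_on (fun i => i \in ex G v) (g v) &
      forall rho, law q g rho = mu rho].
Proof.
move=> approx.
(* Tabulating [g] on finite functions leaves finitely many candidates. *)
pose GT := {dffun forall v, {ffun {ffun dU G -> 'I_N.+1} -> S v}}.
pose gf (h : GT) v (a : dU G -> 'I_N.+1) : S v := h v (finfun a).
(* [Phi] vanishes exactly on the admissible parameters with response law [mu]. *)
pose Phi (h : GT) (x : 'rV[R]_n) : R :=
  \sum_rho `|law (point x) (gf h) rho - mu rho| +
  (\sum_u `|\sum_i point x u i - 1| +
   \sum_u \sum_(i : 'I_N.+1 | (component_size S u <= i)%N) `|point x u i|).
have cpoint u i : continuous (fun x => point x u i) by exact: coord_continuous.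
have addc : continuous (fun z : R * R => z.1 + z.2) by exact: add_continuous.
have mulc : continuous (fun z : R * R => z.1 * z.2) by exact: mul_continuous.
have csum (I : finType) (D : pred I) (f : I -> 'rV[R]_n -> R) :
    (forall i, D i -> continuous (f i)) -> continuous (fun x => \sum_(i | D i) f i x).
  by move=> cf; exact: (continuous_big addc).
have cprod (I : finType) (D : pred I) (f : I -> 'rV[R]_n -> R) :
    (forall i, D i -> continuous (f i)) -> continuous (fun x => \prod_(i | D i) f i x).
  by move=> cf; exact: (continuous_big mulc).
have cadd (f g : 'rV[R]_n -> R) :
    continuous f -> continuous g -> continuous (fun x => f x + g x).
  by move=> cf cg x; exact: (cvgD (cf x) (cg x)).
have ccst (a : R) : continuous (fun _ : 'rV[R]_n => a).
  exact: cst_continuous.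
have cnorm (f : 'rV[R]_n -> R) : continuous f -> continuous (fun x => `|f x|).
  by move=> cf x; exact: (cvg_norm (cf x)).
have cPhi h : continuous (Phi h).
  apply: (cadd); [|apply: (cadd)]; apply: (csum) => i _.
  - apply/cnorm/cadd => //; apply: (csum) => a _ x.
    apply: (cvgM _ (ccst _ x)).
    have cw : continuous (fun x => weight (point x) a).
      by apply: (cprod) => u _; exact: cpoint.
    exact: cw.
  - by apply/cnorm/cadd => //; apply: (csum) => j _; exact: cpoint.
  - by apply: (csum) => j _; apply/cnorm/cpoint.
pose K := [set x : 'rV[R]_n | forall i, `[0, 1]%classic (x ord0 i)].
have cK : compact K.
  exact: (@rV_compact R n (fun=> `[0, 1]%classic) (fun=> @segment_compact R 0 1)).
pose Gam := [set h : GT | forall v, depends_on (fun i => i \in ex G v) (gf h v)].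
pose Z := \bigcup_(h in Gam) (Phi h @` K).
(* A finite union of compact images; it remains to find points of [Z] arbitrarily close to 0. *)
have clZ : closed Z.
  apply: closed_bigcup => [|h _]; first exact: finite_finset.
  apply: compact_closed; first exact: norm_hausdorff.
  by apply: continuous_compact cK; exact: continuous_subspaceT.
have : Z 0.
  apply: clZ => B /nbhs_ballP[e /= e0 eB].
  pose m := #|{: {dffun forall v, S v}}|.
  have e1 : 0 < e / m.+1%:R by rewrite divr_gt0.
  have [q [g [qpmf q0 dg gmu]]] := approx _ e1.
  pose h : GT := [ffun v => [ffun a : {ffun dU G -> 'I_N.+1} => g v a]].
  have hE : gf h = g.
    apply/functional_extensionality_dep => v; apply/funext => a; rewrite /gf !ffunE.
    by congr (g v); apply/funext => u; rewrite ffunE.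
  pose x : 'rV[R]_n := \row_i q (enum_val i).1 (enum_val i).2.
  have xE : point x = q.
    by apply/funext => u; apply/funext => i; rewrite /point mxE enum_rankK.
  exists (Phi h x); split.
    exists h; first by move=> v; rewrite hE.
    exists x => // i; rewrite /= in_itv/= mxE; have [q0' q1] := qpmf (enum_val i).1.
    by rewrite q0' -q1 (bigD1 (enum_val i).2)//= lerDl sumr_ge0.
  apply: eB; rewrite /ball/= sub0r normrN /Phi hE xE.
  rewrite [X in _ + (X + _)]big1 => [|u _]; last first.
    by rewrite (proj2 (qpmf u)) subrr normr0.
  rewrite [X in _ + (_ + X)]big1 => [|u _]; last first.
    by rewrite big1// => i /q0 ->; rewrite normr0.
  rewrite !addr0 ger0_norm ?sumr_ge0//.
  apply: le_lt_trans (ler_sum _ (fun rho _ => gmu rho)) _.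
  rewrite sumr_const -[ltLHS]mulr_natr -mulrA gtr_pMr// mulrC ltr_pdivrMr// mul1r.
  by rewrite ltr_nat.
case=> h dh [x Kx /eqP].
have s0 : 0 <= \sum_rho `|law (point x) (gf h) rho - mu rho| by rewrite sumr_ge0.
have t0 : 0 <= \sum_u `|\sum_i point x u i - 1| by rewrite sumr_ge0.
have w0 : 0 <= \sum_u \sum_(i : 'I_N.+1 | (component_size S u <= i)%N) `|point x u i|.
  by rewrite sumr_ge0// => u _; rewrite sumr_ge0.
rewrite /Phi paddr_eq0 ?addr_ge0// paddr_eq0// !psumr_eq0//; last first.
  by move=> u _; rewrite sumr_ge0.
move=> /and3P[/allP s /allP t /allP w].
exists (point x), (gf h); split=> // [u|u i ui|rho].
- split=> [i|]; first by have := Kx (enum_rank (u, i)); rewrite /= in_itv/= => /andP[].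
  by have := t u (mem_index_enum _); rewrite normr_eq0 subr_eq0 => /eqP.
- have := w u (mem_index_enum _); rewrite /= psumr_eq0// => /allP /(_ i (mem_index_enum _)).
  by rewrite ui normr_eq0 => /eqP.
by have := s rho (mem_index_enum _); rewrite normr_eq0 subr_eq0 => /eqP.
Qed.

End Compactness.

(** * Canonical models *)

Section DiscreteProbability.

(* [T] with all sets measurable; [t] only serves to make the type pointed. *)
Definition discrete (T : choiceType) (t : T) : Type := T.

Section Instances.
Variables (T : choiceType) (t : T).

HB.instance Definition _ := Choice.on (discrete t).
HB.instance Definition _ := isPointed.Build (discrete t) t.
HB.instance Definition _ := @isMeasurable.Build default_measure_display
  (discrete t) discrete_measurable discrete_measurable0
  discrete_measurableC discrete_measurableU.

End Instances.

Lemma discrete_probability (R : realType) (T : finType) (t : T) (w : T -> R) :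
  is_pmf w -> exists P : probability (discrete t) R,
    forall A, P A = (\sum_i w i * (i \in A)%:R)%:E.
Proof.
move=> [w0 w1].
have [m mE] : exists m : {measure set (discrete t) -> \bar R},
    forall A, m A = (\sum_i w i * (i \in A)%:R)%:E.
  elim: (index_enum T) => [|i s [m mE]].
    by exists mzero => A; rewrite big_nil.
  pose wi := NngNum (w0 i).
  exists (measure_add (mscale wi (dirac (i : discrete t))) m) => A.
  rewrite -[LHS]/(measure_add (mscale wi (dirac (i : discrete t))) m A).
    by rewrite measure_addE mE big_cons EFinD EFinM.
have mT : m setT = 1%E.
  rewrite mE (eq_bigr w) ?w1// => i _.
  by rewrite in_setT mulr1.
(* The mass is already one; normalising only supplies the structure of a probability. *)
exists (mnormalize m (dirac (t : discrete t))) => A.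
rewrite /= /mnormalize mT ifF; last by apply/negbTE; rewrite negb_or onee_neq0.
by rewrite /= invr1 mule1; exact: mE.
Qed.

End DiscreteProbability.

Lemma expect_prod (R : realFieldType) (U L : finType) (p h : U -> L -> R) :
  expect p (fun a => \prod_u h u (a u)) = \prod_u \sum_t p u t * h u t.
Proof.
rewrite bigA_distr_bigA; apply: eq_bigr => a _.
by rewrite /weight -big_split.
Qed.

Lemma generated_fin_bigcap (T : pointedType) (C : set (set T)) (I : finType)
    (D : set I) (F : I -> set T) :
  (forall i, D i -> <<s C >> (F i)) -> <<s C >> (\bigcap_(i in D) F i).
Proof.
by move=> CF; apply: (@fin_bigcap_measurable _ (g_sigma_algebraType C)).
Qed.

Lemma generated_fin_bigcup (T : pointedType) (C : set (set T)) (I : finType)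
    (D : set I) (F : I -> set T) :
  (forall i, D i -> <<s C >> (F i)) -> <<s C >> (\bigcup_(i in D) F i).
Proof.
by move=> CF; apply: (@fin_bigcup_measurable _ (g_sigma_algebraType C)).
Qed.

(** * Counterfactuals as functions of the responses *)

Section Responses.
Variables (R : realType) (G : dag) (Om : dV G -> finType) (x0 : asg G Om).

Definition response_fun (v : dV G) : finType := {ffun pa_asg G Om v -> Om v}.

Definition restrict (v : dV G) (x : asg G Om) : pa_asg G Om v :=
  [ffun w : {w : dV G | w \in pa G v} => x (sval w)].

(* Completes a parent assignment by the arbitrary values of [x0] off [pa G v]. *)
Definition extend (v : dV G) (y : pa_asg G Om v) : asg G Om := fun w =>
  if @idP (w \in pa G v) is ReflectT wv then y (exist _ w wv) else x0 w.

Lemma extendE v (y : pa_asg G Om v) w (wv : w \in pa G v) :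
  extend y w = y (exist _ w wv).
Proof.
rewrite /extend; case: {-}_ / idP => [wv'|//].
by rewrite (bool_irrelevance wv' wv).
Qed.

Lemma extendK v : cancel (@extend v) (@restrict v).
Proof.
by move=> y; apply/ffunP => -[w wv]; rewrite ffunE (extendE y wv).
Qed.

Lemma restrictK v (x : asg G Om) w : w \in pa G v -> extend (restrict v x) w = x w.
Proof. by move=> wv; rewrite (extendE _ wv) ffunE. Qed.

(** The structural function expects a total assignment; by [f_pa] the completion made by [extend]
    does not affect the value. *)
Definition response (M : scm R G Om) (v : dV G) (o : sO R G Om M) : response_fun v :=
  [ffun y => f R G Om M v (extend y) o].

Definition all_responses (M : scm R G Om) (o : sO R G Om M) :
  {dffun forall v, response_fun v} := [ffun v => response v o].

Lemma all_responsesP (M : scm R G Om) (o : sO R G Om M) rho :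
  all_responses o = rho <-> (forall v, response v o = rho v).
Proof.
split=> [<- v|ro]; first by rewrite ffunE.
by apply/ffunP => v; rewrite ffunE ro.
Qed.

Lemma all_responsesE (M : scm R G Om) v (x : asg G Om) (o : sO R G Om M) :
  all_responses o v (restrict v x) = f R G Om M v x o.
Proof. by rewrite !ffunE; apply: f_pa => w wv; rewrite restrictK. Qed.

(** Fixing a response function means fixing finitely many values of the structural function, each an
    event generated by the exogenous parents. *)
Lemma response_approximable (M : scm R G Om) v (y : response_fun v) :
  approximable (sP R G Om M) (uX R G Om M) (ex G v) (@response M v @^-1` [set y]).
Proof.
apply: approximable_sigma; first exact: uX_meas.
rewrite (_ : _ @^-1` _ = \bigcap_(z in [set: pa_asg G Om v])
    (f R G Om M v (extend z) @^-1` [set y z])).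
  by apply: generated_fin_bigcap => z _; exact: f_meas.
apply/seteqP; split=> [o /= <- z _ /=|o oy]; first by rewrite ffunE.
by apply/ffunP => z; rewrite ffunE; exact: oy.
Qed.

Definition responses_law (M : scm R G Om) (rho : {dffun forall v, response_fun v}) : R :=
  prob (sP R G Om M) [set o | forall v, response v o = rho v].

Lemma all_responses_fiber (M : scm R G Om) rho :
  @all_responses M @^-1` [set rho] = [set o | forall v, response v o = rho v].
Proof. by apply/seteqP; split=> o /all_responsesP. Qed.

Lemma measurable_all_responses (M : scm R G Om) rho :
  measurable (@all_responses M @^-1` [set rho]).
Proof.
rewrite all_responses_fiber.
rewrite (_ : [set o | _] =
  \bigcap_(v in [set: dV G]) (@response M v @^-1` [set rho v])).
  apply: fin_bigcap_measurable => [|v _]; first exact: finite_finset.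
  by case: (response_approximable M (rho v)).
by apply/seteqP; split=> [o ro v _|o ro v]; [exact: ro|exact: (ro v)].
Qed.

(** There are finitely many response vectors, so the probability of any predicate on them is a
    finite sum of values of the law. *)
Lemma eq_responses_law (M N : scm R G Om) (Q : pred {dffun forall v, response_fun v}) :
  responses_law M =1 responses_law N ->
  sP R G Om M [set o | Q (all_responses o)] = sP R G Om N [set o | Q (all_responses o)].
Proof.
move=> MN.
have mQ (M' : scm R G Om) : measurable [set o : sO R G Om M' | Q (all_responses o)].
  rewrite (_ : [set o | _] = \bigcup_(rho in [set rho | Q rho])
      (@all_responses M' @^-1` [set rho])).
    apply: fin_bigcup_measurable => [|rho _]; first exact: finite_finset.
    exact: measurable_all_responses.
  by apply/seteqP; split=> [o /= Qo|o [rho /= Qr ->]//]; exists (all_responses o).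
rewrite !probE//; congr (_%:E).
rewrite (prob_discrete _ Q (@measurable_all_responses M)).
rewrite (prob_discrete _ Q (@measurable_all_responses N)).
by apply: eq_bigr => rho _; rewrite !all_responses_fiber; congr (_ * _); exact: MN.
Qed.

(** The counterfactual event read off a vector of response functions, hence without reference to a
    model. *)
Definition event_of (t : cterm G Om) (rho : {dffun forall v, response_fun v}) : Prop :=
  exists s : asg G Om,
    (forall v, s v = if v \in cX G Om t then cx G Om t v else rho v (restrict v s)) /\
    (forall v, v \in cY G Om t -> s v = cy G Om t v).

Lemma ceventE (M : scm R G Om) (t : cterm G Om) :
  cevent R G Om M t = [set o | event_of t (all_responses o)].
Proof.
apply/seteqP; split=> o [s [sM sY]]; exists s; split=> // v.
  by rewrite all_responsesE sM.
by rewrite -all_responsesE sM.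
Qed.

Lemma eq_law_intprob (M N : scm R G Om) z v :
  responses_law M =1 responses_law N -> intprob M z v = intprob N z v.
Proof.
move=> MN; rewrite /intprob !ceventE; set t := CTerm _ _ _ _ _ _.
have := eq_responses_law (fun rho => `[< event_of t rho >]) MN.
have E (M' : scm R G Om) : [set o : sO R G Om M' | `[< event_of t (all_responses o) >]] =
    [set o | event_of t (all_responses o)].
  by apply/seteqP; split=> o /asboolP.
by rewrite !E.
Qed.

Lemma eq_law_cfprob (M N : scm R G Om) n (ev : 'I_n -> cterm G Om) :
  responses_law M =1 responses_law N -> cfprob M ev = cfprob N ev.
Proof.
move=> MN; rewrite /cfprob.
have := eq_responses_law (fun rho => `[< forall i, event_of (ev i) rho >]) MN.
have E (M' : scm R G Om) :
    [set o : sO R G Om M' | `[< forall i, event_of (ev i) (all_responses o) >]] =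
    \bigcap_(i in [set: 'I_n]) cevent R G Om M' (ev i).
  apply/seteqP; split=> [o /asboolP Eo i _|o Eo]; first by rewrite ceventE; exact: Eo.
  by apply/asboolP => i; have := Eo i I; rewrite ceventE.
by rewrite !E.
Qed.

End Responses.

(** * Construction of a canonical model *)

Section CanonicalModel.
Variables (R : realType) (G : dag) (Om : dV G -> finType) (x0 : asg G Om) (K : nat).
Hypothesis card_gt0 : forall u, (0 < can_card G Om u)%N.
Hypothesis card_le : forall u, (can_card G Om u <= K.+1)%N.
Variables (q : dU G -> 'I_K.+1 -> R).
Variable g : forall v, (dU G -> 'I_K.+1) -> response_fun Om v.
Hypothesis q_pmf : forall u, is_pmf (q u).
Hypothesis q_supp : forall u (i : 'I_K.+1), (can_card G Om u <= i)%N -> q u i = 0.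
Hypothesis g_ex : forall v, depends_on (fun u => u \in ex G v) (g v).

Let i0 u : 'I_(can_card G Om u) := Ordinal (card_gt0 u).
Let label := {ffun dU G -> 'I_K.+1}.
Let a0 : label := [ffun=> ord0].
(** Labels from [can_card G Om u] on have weight zero; sending them to [i0 u] gives each exogenous
    domain exactly the canonical cardinality. *)
Let trunc u (l : 'I_K.+1) : 'I_(can_card G Om u) := insubd (i0 u) (l : nat).
Let X u (a : discrete a0) : discrete (i0 u) := trunc u ((a : label) u).
Let back u (i : 'I_(can_card G Om u)) : 'I_K.+1 := widen_ord (card_le u) i.
(** Labels are read only through [X], so [F] is a function of the exogenous variables everywhere and
    not just on the support. *)
Let F v (x : asg G Om) (a : discrete a0) : Om v :=
  g v (fun u => back (X u a)) (restrict v x).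

Let truncK u (l : 'I_K.+1) : q u l != 0 -> back (trunc u l) = l.
Proof.
move=> ql; apply: val_inj; rewrite /= val_insubd.
by case: ltnP => // cl; rewrite q_supp ?eqxx in ql.
Qed.

(** The sample space consists of all label vectors under the product weight; the exogenous variables
    are the truncated coordinates. *)
Lemma canonical_model_exists : exists N : scm R G Om,
  canonical_scm N /\ responses_law x0 N =1 law q g.
Proof.
have wpmf : is_pmf (weight q).
  split=> [a|]; first by apply: prodr_ge0 => u _; case: (q_pmf u).
  rewrite -(expect1 (fun u => proj2 (q_pmf u))).
  by apply: eq_bigr => a _; rewrite mulr1.
have [P PE] := discrete_probability a0 wpmf.
have probPE A : prob P A = expect q (fun a => ([ffun u => a u] \in A)%:R).
  rewrite /prob PE/=; apply: eq_bigr => a _; congr (_ * (_ \in A)%:R).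
  by apply/ffunP => u; rewrite ffunE.
have mX u : measurable_fun setT (X u) by [].
have indepX (A : forall u, set (discrete (i0 u))) : (forall u, measurable (A u)) ->
    fine (P (\bigcap_(u in [set: dU G]) (X u @^-1` A u))) =
    \prod_(u : dU G) fine (P (X u @^-1` A u)).
  move=> _; rewrite -/(prob P _) probPE.
  (* The indicator of a box is a product over the coordinates, so its expectation factors. *)
  pose h u (l : 'I_K.+1) : R := (trunc u l \in A u)%:R.
  transitivity (expect q (fun a => \prod_u h u (a u))).
    apply: expect_ext => a; rewrite ffunK; have [aA|aA] := boolP (_ \in _).
      rewrite big1// => u _; rewrite /h (_ : trunc u (a u) \in A u)//.
      by apply: mem_set; move/set_mem : aA => /(_ u I).
    apply/esym/eqP; rewrite prodf_seq_eq0; apply: contraNT aA => /hasPn h0.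
    apply: mem_set => u _; have := h0 u (mem_index_enum _).
    by rewrite /h /=; case: (boolP (_ \in _)) => [/set_mem//|_]; rewrite eqxx.
  rewrite expect_prod; apply: eq_bigr => u _; rewrite -/(prob P _) probPE.
  (* A condition on one coordinate is a box whose other sides are full. *)
  transitivity (expect q (fun a => \prod_i (if i == u then h i (a i) else 1))).
    rewrite (expect_prod q (fun i l => if i == u then h i l else 1)).
    rewrite (bigD1 u)//= eqxx [X in _ = _ * X]big1 ?mulr1// => i /negPf ->.
    by under eq_bigr do rewrite mulr1; case: (q_pmf i).
  apply: expect_ext => a; rewrite ffunK -big_mkcond big_pred1_eq /h.
  by congr (_%:R); congr nat_of_bool; apply/idP/idP => /set_mem ?; apply: mem_set.
have F_pa v (x x' : asg G Om) o : (forall w, w \in pa G v -> x w = x' w) ->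
    F v x o = F v x' o.
  move=> xx'; rewrite /F; congr (g v _ _); apply/ffunP => -[w wv].
  by rewrite !ffunE /= xx'.
have F_meas v (x : asg G Om) (y : Om v) :
  <<s \bigcup_(u in [set u | u \in ex G v])
        [set X u @^-1` B | B in [set B : set (discrete (i0 u)) | measurable B]] >>
    (F v x @^-1` [set y]).
  (* By [g_ex] the event is the finite union, over its members [b], of the sets where the exogenous
     parents of [v] take the same values as at [b]. *)
  rewrite (_ : F v x @^-1` _ = \bigcup_(b in [set b : label | F v x b = y])
      \bigcap_(u in [set u | u \in ex G v]) (X u @^-1` [set X u b])).
    apply: generated_fin_bigcup => b _; apply: generated_fin_bigcap => u uv.
    by apply: sub_sigma_algebra; exists u => //; exists [set X u b].
  apply/seteqP; split=> [a /= ay|a [b /= <- ab]]; first by exists a.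
  rewrite /F; congr (fun_of_fin _ _); apply: g_ex => u uv.
  by rewrite (ab u uv).
pose N := @SCM R G Om _ (discrete a0) P _ (fun u => discrete (i0 u)) X F
  mX indepX F_pa F_meas.
exists N.
split=> [u|rho].
  split=> //; exists id; by exists id.
rewrite /responses_law probPE /law; apply: expect_supp => a qa.
rewrite ffunK.
have aE v : g v (fun u => back (X u a)) = g v a.
  by apply: g_ex => u _; rewrite /X truncK.
have rE v : @response R G Om x0 N v a = g v a.
  by rewrite -aE; apply/ffunP => y; rewrite ffunE /= /F extendK.
have [aR|aR] := boolP (_ \in _).
  rewrite big1// => v _; move: aR; rewrite inE => /(_ v).
  by rewrite rE => ->; rewrite eqxx.
apply/esym/eqP; rewrite prodf_seq_eq0; apply: contraNT aR => /hasPn h0.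
rewrite inE => v; have := h0 v (mem_index_enum _); rewrite /= rE.
by case: (g v a =P rho v) => // _; rewrite eqxx.
Qed.

End CanonicalModel.

(** The finite approximations are made canonical before the limit is taken: the bound on the number
    of labels is then uniform in the error, and the parameters stay in one cube. *)
Lemma canonical_scm_complete (R : realType) (G : dag) (Om : dV G -> finType)
    (x0 : asg G Om) (M : scm R G Om) :
  exists N : scm R G Om, canonical_scm N /\ responses_law x0 N =1 responses_law x0 M.
Proof.
pose S := response_fun Om.
pose rho0 : {dffun forall v, S v} := [ffun v => [ffun=> x0 v]].
have card_gt0 u : (0 < can_card G Om u)%N.
  apply: prodn_cond_gt0 => v _; apply/card_gt0P.
  by exists [ffun=> x0 v].
pose K := \max_u can_card G Om u.
(* The successor keeps the label type inhabited even when there are no exogenous nodes. *)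
have card_le u : (can_card G Om u <= K.+1)%N by apply: leqW; exact: leq_bigmax.
have [|q [g [qpmf qs dg qg]]] := @law_closed R G S K (responses_law x0 M).
  move=> e e0.
  have [L [p [h [ppmf dh hM]]]] := law_approx (@uX_meas R G Om M)
    (@uX_indep R G Om M) rho0 (@response_approximable R G Om x0 M) e0.
  have [q [g [qpmf qs dg qg]]] := canonical_labels rho0 card_le ppmf dh.
  by exists q, g; split=> // rho; rewrite qg; exact: hM.
have [N [Ncan Nlaw]] := canonical_model_exists x0 card_gt0 card_le qpmf qs dg.
by exists N; split=> // rho; rewrite Nlaw.
Qed.

(** * Tightness of the canonical bounds *)

Unset Implicit Arguments.

Theorem theorem2 (R : realType) (G : dag) (Om : dV G -> finType)
  (k : nat) (Zs : 'I_k -> intv G Om) (Pz : 'I_k -> asg G Om -> R)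
  (n : nat) (ev : 'I_n -> cterm G Om) (l r : R) :
  let feasible (Mx : scm R G Om) :=
    forall (i : 'I_k) (v : asg G Om), intprob Mx (Zs i) v = (Pz i v)%:E in
  let q (Mx : scm R G Om) := cfprob Mx ev in
  is_min (fun Nx => canonical_scm Nx /\ feasible Nx) q l ->
  is_max (fun Nx => canonical_scm Nx /\ feasible Nx) q r ->
  is_min feasible q l /\ is_max feasible q r.
Proof.
move=> feasible q [[Nl [[Nlc Nlf] Nlq]] lmin] [[Nr [[_ Nrf] Nrq]] rmax].
(* Canonical feasible models are feasible, so both optima stay attained; the bounds extend once
   every feasible model has a canonical feasible one with the same [q]. *)
have canon M : feasible M ->
    exists N, (canonical_scm N /\ feasible N) /\ q N = q M.
  move=> Mf; have [[x0 _]|noasg] := pselect (exists x : asg G Om, True).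
    have [N [Ncan NM]] := canonical_scm_complete x0 M.
    exists N; split; last exact: eq_law_cfprob NM.
    by split=> // i v; rewrite (eq_law_intprob _ _ NM) Mf.
  (* Some domain is empty: [cterm] is then empty too, so [n] is 0 and [q] is 1. *)
  exists Nl; split=> //; rewrite /q /cfprob.
  have noev (M' : scm R G Om) :
      \bigcap_(i in [set: 'I_n]) cevent R G Om M' (ev i) = setT.
    apply/seteqP; split=> // o _ i _; case: noasg.
    by exists (cy G Om (ev i)).
  by rewrite !noev !probability_setT.
split; split.
- by exists Nl.
- by move=> M /canon[N [Nf <-]]; exact: lmin.
- by exists Nr.
- by move=> M /canon[N [Nf <-]]; exact: rmax.
Qed.
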